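(* Generically, the sum of two affine Cantor sets has positive Lebesgue measure provided the sum of their Hausdorff dimensions is greater than one. Precisely: let $m,m'\ge2$. Then for Lebesgue-almost every pair $(p,q)\in\mathcal{P}_m\times\mathcal{P}_{m'}\subset\mathbb{R}^{2m}\times\mathbb{R}^{2m'}$ of admissible parameter tuples, if $\dim_HC_p+\dim_HC_q>1$, then $C_p+C_q=\{x+y:x\in C_p,\ y\in C_q\}$ has positive Lebesgue measure.
   Context: For $m\ge2$, a tuple $p=(\lambda_1,\dots,\lambda_m,d_1,\dots,d_m)\in\mathbb{R}^{2m}$ with all $\lambda_k\in(-1,0)\cup(0,1)$ is called admissible if the affine maps $\varphi_k(x)=\lambda_kx+d_k$ satisfy $\varphi_k([0,1])\subseteq[0,1]$ for each $k=1,\dots,m$ and $\varphi_i([0,1])\cap\varphi_j([0,1])=\emptyset$ for $i\ne j$. The set of admissible tuples is denoted $\mathcal{P}_m\subset\mathbb{R}^{2m}$. For $p\in\mathcal{P}_m$ the affine Cantor set $C_p$ is $\bigcap_{n\ge0}I_n$, where $I_0=[0,1]$ and $I_{n+1}=\bigcup_{k=1}^m\varphi_k(I_n)$. $\dim_H$ is Hausdorff dimension. *)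

(* Defs.v *)
From HB Require Import structures.
From mathcomp Require Import all_boot all_order all_algebra.
From mathcomp Require Import all_classical all_reals all_analysis.

Set Implicit Arguments.
Unset Strict Implicit.
Unset Printing Implicit Defensive.

Import Order.TTheory GRing.Theory Num.Theory.

Local Open Scope classical_set_scope.
Local Open Scope ring_scope.

(* The library's sigma-finite instance on m1 \x m2 is shadowed by one that
   only applies to subprobabilities. *)
Lemma sigma_finite_product d1 d2 (T1 : measurableType d1)
    (T2 : measurableType d2) (R : realType)
    (m1 : {sigma_finite_measure set T1 -> \bar R})
    (m2 : {sigma_finite_measure set T2 -> \bar R}) :
  sigma_finite [set: T1 * T2] (m1 \x m2)%E.
Proof.
have /sigma_finiteP[F [TF ndF Foo]] := sigma_finiteT m1.
have /sigma_finiteP[G [TG ndG Goo]] := sigma_finiteT m2.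
exists (fun n => F n `*` G n).
  rewrite -setXTT TF TG predeqE => -[x y]; split.
    move=> [/= [n _ Fnx] [k _ Gky]]; exists (maxn n k) => //; split.
      by move: x Fnx; exact/subsetPset/ndF/leq_maxl.
    by move: y Gky; exact/subsetPset/ndG/leq_maxr.
  by move=> [n _ []/= ? ?]; split; exists n.
move=> k; have [mFk Fkoo] := Foo k; have [mGk Gkoo] := Goo k; split.
  exact: measurableX.
by rewrite product_measure1E// lte_mul_pinfty// ge0_fin_numE.
Qed.

(* R^n is n.-tuple R with its product (Borel) sigma-algebra; its Lebesgue
   measure is the n-fold product of the one-dimensional one, built by
   transporting R * R^n onto R^(n+1); see lebesgue_tuple_box. *)
Section lebesgue_tuple.
Local Open Scope ereal_scope.
Context {R : realType}.
Local Notation mR := (measurableTypeR R).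

Definition tuple_cons n (x : mR * n.-tuple mR) : n.+1.-tuple mR :=
  [tuple of x.1 :: x.2].

Lemma measurable_tuple_cons n :
  measurable_fun [set: mR * n.-tuple mR] (@tuple_cons n).
Proof. exact: measurable_cons. Qed.

Section succ.
Variables (n : nat) (mu : {sigma_finite_measure set (n.-tuple mR) -> \bar R}).

Definition lebesgue_tuple_succ : set (n.+1.-tuple mR) -> \bar R :=
  pushforward (lebesgue_measure \x mu) (@tuple_cons n).

Let nu : {measure set (n.+1.-tuple mR) -> \bar R} :=
  measure_function_pushforward__canonical__measure_function_Measure
    (lebesgue_measure \x mu) (@measurable_tuple_cons n).

Let succ0 : lebesgue_tuple_succ set0 = 0.
Proof. exact: (measure0 nu). Qed.

Let succ_ge0 A : 0 <= lebesgue_tuple_succ A.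
Proof. exact: (measure_ge0 nu). Qed.

Let succ_sigma_additive : semi_sigma_additive lebesgue_tuple_succ.
Proof. exact: (@measure_semi_sigma_additive _ _ _ nu). Qed.

HB.instance Definition _ := isMeasure.Build _ _ _ lebesgue_tuple_succ
  succ0 succ_ge0 succ_sigma_additive.

Let succ_sigma_finite : sigma_finite [set: n.+1.-tuple mR] lebesgue_tuple_succ.
Proof.
have [F FT Foo] := sigma_finite_product lebesgue_measure mu.
pose split_tuple (t : n.+1.-tuple mR) : mR * n.-tuple mR :=
  (thead t, [tuple of behead t]).
have splitK : cancel (@tuple_cons n) split_tuple.
  by move=> [a t]; rewrite /split_tuple theadE; congr pair; exact: val_inj.
have msplit : measurable_fun [set: n.+1.-tuple mR] split_tuple.
  apply/measurable_fun_pair; last exact: measurable_behead.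
  exact: measurable_tnth.
exists (fun i => split_tuple @^-1` F i).
  by rewrite -preimage_bigcup -FT preimage_setT.
move=> i; have [mF Fi] := Foo i; split.
  by rewrite -[X in measurable X]setTI; exact: msplit.
rewrite /lebesgue_tuple_succ /pushforward -comp_preimage.
by rewrite (_ : _ \o _ = id) ?preimage_id//; apply/funext => x; exact: splitK.
Qed.

HB.instance Definition _ := @Measure_isSigmaFinite.Build _ _ _
  lebesgue_tuple_succ succ_sigma_finite.

End succ.

Fixpoint lebesgue_tuple n : {sigma_finite_measure set (n.-tuple mR) -> \bar R} :=
  match n with
  | 0 => \d_([tuple] : 0.-tuple mR)
  | n'.+1 => lebesgue_tuple_succ (lebesgue_tuple n')
  end.

Lemma lebesgue_tuple_box n (A : 'I_n -> set mR) :
    (forall i, measurable (A i)) ->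
  lebesgue_tuple n [set t | forall i, A i (tnth t i)] =
  \prod_(i < n) lebesgue_measure (A i).
Proof.
elim: n A => [|n ih] A mA.
  by rewrite big_ord0 /= diracE mem_set//= => -[].
rewrite big_ord_recl /= /lebesgue_tuple_succ /pushforward.
rewrite -ih; last by move=> i; exact: mA.
have mB : measurable
    [set t : n.-tuple mR | forall i, A (lift ord0 i) (tnth t i)].
  rewrite (_ : [set _ | _] =
      \bigcap_(i in [set: 'I_n]) (fun t => tnth t i) @^-1` A (lift ord0 i)).
    apply: fin_bigcap_measurable => // i _.
    by rewrite -[X in measurable X]setTI; apply: measurable_tnth => //; exact: mA.
  by apply/seteqP; split => [t At i _|t At i]; exact: At.
rewrite -product_measure1E//=; congr (_ \x _).
apply/seteqP; split => [[a t] /= At|[a t] /= [Aa At] i].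
  by split=> [|i]; [have := At ord0|have := At (lift ord0 i); rewrite tnthS].
by case: (unliftP ord0 i) => [j ->|-> //]; rewrite tnthS.
Qed.

End lebesgue_tuple.

Section hausdorff.
Local Open Scope ereal_scope.
Context {R : realType}.
Implicit Types (s delta : R) (E U : set R).

Definition diameter U : \bar R :=
  ereal_sup [set (`|x - y|%R)%:E | x in U & y in U].

(* The empty set contributes 0 also for s = 0, where diameter `^ 0 is 1. *)
Definition diameter_pow s U : \bar R :=
  if U == set0 then 0 else diameter U `^ s.

Definition hausdorff_premeasure s delta E : \bar R :=
  ereal_inf [set \sum_(0 <= i <oo) diameter_pow s (U i) | U in
    [set U : (set R)^nat |
      (forall i, diameter (U i) <= delta%:E) /\ E `<=` \bigcup_i U i]].

Definition hausdorff_measure s E : \bar R :=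
  ereal_sup [set hausdorff_premeasure s delta E
            | delta in [set delta | (0 < delta)%R]].

Definition hausdorff_dim E : \bar R :=
  ereal_inf [set s%:E | s in [set s | (0 <= s)%R /\ hausdorff_measure s E = 0]].

End hausdorff.

(* A parameter p = (lambda_1, ..., lambda_m, d_1, ..., d_m) is an
   (m + m)-tuple: the first m entries are the ratios, the last m the
   translations. *)
Section affine_cantor.
Context {R : realType} (m : nat).
Implicit Types (p : (m + m).-tuple R) (k : 'I_m).

Definition ratio p k : R := tnth p (lshift m k).

Definition translation p k : R := tnth p (rshift m k).

Definition affine_map p k (x : R) : R := ratio p k * x + translation p k.

Definition admissible p : Prop :=
  [/\ forall k, (`]-1, 0[ `|` `]0, 1[) (ratio p k),
      forall k, affine_map p k @` `[0, 1] `<=` `[0, 1] &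
      forall i j, i != j ->
        affine_map p i @` `[0, 1] `&` affine_map p j @` `[0, 1] = set0].

Fixpoint cantor_level p (n : nat) : set R :=
  match n with
  | 0 => `[0, 1]
  | n'.+1 => \bigcup_(k in [set: 'I_m]) (affine_map p k @` cantor_level p n')
  end.

Definition affine_cantor p : set R := \bigcap_n cantor_level p n.

End affine_cantor.

Definition sumset {R : realType} (A B : set R) : set R :=
  [set x + y | x in A & y in B].

(* Main.v *)
From Pilot Require Import Defs.
From mathcomp Require Import all_boot all_order all_algebra.
From mathcomp Require Import all_classical all_reals all_analysis.
From mathcomp Require Import measurable_realfun.
From mathcomp Require Import ring lra.

(** The set of parameters is stable under a dilation that is visible on the
    Cantor sets: multiplying all the translations of [q] by [t] while keeping
    the ratios multiplies the Cantor set of [q] by [t].  By Tonelli's theorem it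
    is therefore enough to fix [p] and [q], and to prove that the sum of the
    Cantor set of [p] and of [t] times the Cantor set of [q] has positive
    measure for almost every [t] between 1 and 2.  This is an instance of
    Marstrand's projection theorem for the product of the two Cantor sets.

    To apply it, one chooses exponents [a] and [b] with [a + b = 1], each of
    which is 0 or lies below the corresponding dimension ([exponent_between]).
    Covering a Cantor set by cylinders shows that its dimension is at most [a]
    as soon as the sum of the [a]-th powers of the ratios is less than 1, so for
    the chosen exponents these sums are greater than 1 ([ratio_sum_gt1]).
    Giving to the
    cylinder of the letter [k] a mass proportional to [`|ratio p k| `^ a]
    defines a multiplicative weight on words; the energy of exponent [a] of the
    resulting clouds of points, one point for each word of length [n],
    truncated at the scale of the cylinders, satisfies a contracting affine
    recursion and is bounded uniformly in [n] ([energy_words_le]).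

    Marstrand's theorem is proved directly for such clouds, without limit measures
    ([marstrand]).  A bound on the number of pairs of points that are close to
    each other, counted with weights, bounds from below the measure of a
    neighbourhood of the cloud ([second_moment]).  The integral over [t] of this
    count for the points [x + t * y] is controlled by the product of the two
    energies, because a pair of points is close to each other only for [t] in a
    short interval ([strip_measure_le]).

    The set to be proved null need not be measurable.  It is enlarged to
    a countable union, over rational exponents, of the measurable sets
    [exceptional k0 k0' a b]. *)

Set Implicit Arguments.
Unset Strict Implicit.
Unset Printing Implicit Defensive.

Import Order.TTheory GRing.Theory Num.Theory numFieldNormedType.Exports.
(* Otherwise [ratio] would denote the type of fractions. *)
Import Pilot.Defs.

Local Open Scope classical_set_scope.
Local Open Scope ring_scope.

(** * A second moment lower bound for Lebesgue measure *)

Section weighted_balls.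
Context {R : realType}.
Local Notation mu := (@lebesgue_measure R).

Lemma integral_sum_indic (I : Type) (s : seq I) (a : I -> R)
    (A : I -> set (measurableTypeR R)) (D : set (measurableTypeR R)) :
  measurable D -> (forall i, 0 <= a i) -> (forall i, measurable (A i)) ->
  (\int[mu]_(x in D) (\sum_(i <- s) a i * \1_(A i) x)%:E =
   \sum_(i <- s) (a i)%:E * mu (A i `&` D))%E.
Proof.
move=> mD a0 mA.
under eq_integral do rewrite -sumEFin.
rewrite ge0_integral_sum//; last 2 first.
- by move=> i; apply/measurable_EFinP; apply: measurable_funM => //.
- by move=> i x _; rewrite lee_fin mulr_ge0.
apply: eq_bigr => i _.
under eq_integral do rewrite EFinM.
rewrite ge0_integralZl//; last 2 first.
- exact/measurable_EFinP.
- by rewrite lee_fin.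
by rewrite integral_indic.
Qed.

(** The weighted sum [g] of the indicators of the balls has integral [2 * r]
    and, since two balls meet only when their centers are closer than
    [2 * r], the integral of [g ^+ 2] is at most [(2 * r) ^+ 2 * L].  The
    Cauchy-Schwarz bound for the measure of the support of [g] takes here the
    form of the pointwise inequality [2 * c * g <= \1_S + c ^+ 2 * g ^+ 2],
    valid for every [c] because [0 <= (1 - c * g) ^+ 2]. *)
Lemma second_moment (I : Type) (s : seq I) (w z : I -> R) (r L : R)
    (S : set (measurableTypeR R)) :
  0 < r -> 0 < L -> (forall i, 0 <= w i) -> \sum_(i <- s) w i = 1 ->
  measurable S -> (forall i, ball (z i) r `<=` S) ->
  \sum_(i <- s) \sum_(j <- s) w i * w j * (`|z i - z j| < 2 * r)%R%:R
    <= 2 * r * L ->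
  (L^-1%:E <= mu S)%E.
Proof.
move=> r0 L0 w0 w1 mS zS HQ.
have mb i : measurable (ball (z i) r : set (measurableTypeR R)).
  exact: measurable_ball.
(* This value maximizes 4 * c * r - c ^+ 2 * (2 * r) ^+ 2 * L. *)
pose c := (2 * r * L)^-1.
have c0 : 0 < c by rewrite invr_gt0 !mulr_gt0.
pose g x := \sum_(i <- s) w i * \1_(ball (z i) r) x : R.
pose s2 := [seq (i, j) | i <- s, j <- s].
pose a2 (ij : I * I) := c ^+ 2 * (w ij.1 * w ij.2).
pose A2 (ij : I * I) : set (measurableTypeR R) :=
  ball (z ij.1) r `&` ball (z ij.2) r.
have g2 x : c ^+ 2 * g x ^+ 2 = \sum_(ij <- s2) a2 ij * \1_(A2 ij) x.
  rewrite /s2 big_allpairs/= (expr2 (g x)) {1}/g mulr_suml mulr_sumr.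
  apply: eq_bigr => i _; rewrite /g mulr_sumr mulr_sumr.
  by apply: eq_bigr => j _; rewrite /a2/= indicI/=; ring.
have g1 x : 2 * c * g x = \sum_(i <- s) (2 * c * w i) * \1_(ball (z i) r) x.
  by rewrite /g mulr_sumr; apply: eq_bigr => i _; rewrite mulrA.
have ptw x : 2 * c * g x <= \1_S x + c ^+ 2 * g x ^+ 2.
  have [xS|xS] := pselect (S x).
    rewrite indicE mem_set//= -subr_ge0.
    have -> : 1 + c ^+ 2 * g x ^+ 2 - 2 * c * g x = (1 - c * g x) ^+ 2 by ring.
    exact: sqr_ge0.
  have -> : g x = 0.
    rewrite /g big1// => i _; rewrite indicE memNset ?mulr0// => /zS.
    exact: xS.
  by rewrite mulr0 expr0n/= mulr0 addr0.
have H1 : (\int[mu]_x (2 * c * g x)%:E = (4 * c * r)%:E)%E.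
  under eq_integral do rewrite g1.
  rewrite integral_sum_indic//; last by move=> i; rewrite !mulr_ge0// ltW.
  under eq_bigr do rewrite setIT lebesgue_measure_ball ?(ltW r0)// -EFinM.
  rewrite sumEFin -mulr_suml -mulr_sumr w1; congr EFin; ring.
have H2 : (\int[mu]_x (c ^+ 2 * g x ^+ 2)%:E <= (c * 2 * r)%:E)%E.
  under eq_integral do rewrite g2.
  rewrite integral_sum_indic//; last 2 first.
  - by move=> ij; rewrite /a2 ?mulr_ge0 ?sqr_ge0// ?ltW//.
  - by move=> ij; exact: measurableI.
  apply: (@le_trans _ _ (\sum_(ij <- s2)
      (a2 ij * ((`|z ij.1 - z ij.2| < 2 * r)%R%:R * (2 * r)))%:E)%E).
    apply: lee_sum => ij _; rewrite (EFinM (a2 ij)); apply: lee_wpmul2l.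
    - by rewrite lee_fin /a2 ?mulr_ge0 ?sqr_ge0// ?ltW//.
    rewrite setIT; have [zz|zz] := ltP.
      rewrite mul1r.
      apply: (@le_trans _ _ (mu (ball (z ij.1) r))).
        by apply: le_measure; rewrite ?inE//; [exact: measurableI|exact: subIsetl].
      by rewrite lebesgue_measure_ball ?(ltW r0)// lee_fin mulr2n mulrDl mul1r.
    rewrite (_ : A2 ij = set0) ?measure0 ?mul0r//.
    rewrite -subset0 => x [] /=; rewrite -!ball_normE/= => h1 h2.
    have := ler_distD x (z ij.1) (z ij.2).
    rewrite (distrC x) => h3; lra.
  rewrite sumEFin lee_fin /s2 big_allpairs /a2/=.
  have -> : \sum_(i <- s) \sum_(j <- s) c ^+ 2 * (w i * w j) *
      ((`|z i - z j| < 2 * r)%R%:R * (2 * r)) = (c ^+ 2 * (2 * r)) *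
    \sum_(i <- s) \sum_(j <- s) w i * w j * (`|z i - z j| < 2 * r)%R%:R.
    rewrite mulr_sumr; apply: eq_bigr => i _; rewrite mulr_sumr.
    apply: eq_bigr => j _; ring.
  have -> : c * 2 * r = (c ^+ 2 * (2 * r)) * (2 * r * L).
    by rewrite /c; field; rewrite !gt_eqF.
  by apply: ler_wpM2l => //; rewrite ?mulr_ge0 ?sqr_ge0// ?ltW//.
have mg : measurable_fun setT (g : measurableTypeR R -> measurableTypeR R).
  apply: measurable_sum => i; apply: measurable_funM => //.
have H3 : (\int[mu]_x (2 * c * g x)%:E <=
           \int[mu]_x (\1_S x)%:E + \int[mu]_x (c ^+ 2 * g x ^+ 2)%:E)%E.
  rewrite -ge0_integralD//.
  - apply: ge0_le_integral => //.
    + move=> x _; rewrite lee_fin g1; apply: sumr_ge0 => i _.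
      by rewrite !mulr_ge0// ltW.
    + by apply/measurable_EFinP; exact: measurable_funM.
    + apply/measurable_EFinP; apply: measurable_funD => //.
      by apply: measurable_funM => //; exact: measurable_funX.
    + by move=> x Dx; rewrite lee_fin.
  - by apply/measurable_EFinP.
  - by move=> x _; rewrite lee_fin mulr_ge0 ?sqr_ge0.
  - apply/measurable_EFinP.
    by apply: measurable_funM => //; exact: measurable_funX.
rewrite H1 integral_indic// setIT in H3.
have := le_trans H3 (leeD2l _ H2).
rewrite -leeBlDr// -EFinB.
suff -> : 4 * c * r - c * 2 * r = L^-1 by [].
by rewrite /c; field; rewrite !gt_eqF.
Qed.

End weighted_balls.

(** * Transversality *)

Section transversality.
Context {R : realType}.
Local Notation mu := (@lebesgue_measure R).

Lemma invr_powR_split (x a b : R) : 0 < x -> a + b = 1 ->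
  x^-1 = (x `^ a)^-1 * (x `^ b)^-1.
Proof.
move=> x0 ab; rewrite -invfM -powRD ?ab ?powRr1 ?(ltW x0)//.
by rewrite gt_eqF// implybT.
Qed.

Lemma measurable_strip (a b r : R) :
  measurable ([set t | `|a + t * b| < r] : set (measurableTypeR R)).
Proof.
rewrite (_ : [set _ | _] = (fun t : R => a + t * b) @^-1` (ball 0 r)).
  rewrite -[X in measurable X]setTI.
  have : measurable_fun setT ((fun t => a + t * b) : measurableTypeR R -> R).
    by apply: measurable_funD => //; exact: measurable_funM.
  by apply => //; exact: measurable_ball.
by apply/seteqP; split => t /=; rewrite -ball_normE/= sub0r normrN.
Qed.

(** The set of parameters is contained in an interval of length
    [4 * r / `|b|], so its measure is of order [r / B] with
    [B = Num.max `|b| r].  It is empty unless [`|a|] is at most of the order of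
    [B], and this allows to trade part of the power of [B] for a power of
    [Num.max `|a| r]: the bound then factors into a function of [a] and a
    function of [b]. *)
Lemma strip_measure_le (a b r al be : R) :
  0 < r -> 0 <= al -> 0 <= be -> al + be = 1 ->
  (mu ([set t : R | (`|a + t * b| < 2 * r)%R] `&` `]1%R, 2%R[%classic) <=
   (16 * r * ((Num.max `|a| r) `^ al)^-1 * ((Num.max `|b| r) `^ be)^-1)%:E)%E.
Proof.
move=> r0 al0 be0 abe1.
set X := _ `&` _; set A := Num.max _ _; set B := Num.max _ _.
have A0 : 0 < A by rewrite /A lt_max r0 orbT.
have B0 : 0 < B by rewrite /B lt_max r0 orbT.
have mX : measurable X.
  by apply: measurableI => //; exact: measurable_strip.
have [->|/set0P[t [/= Ht]]] := eqVneq X set0.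
  by rewrite measure0 lee_fin !mulr_ge0// ?invr_ge0 ?powR_ge0// ltW.
rewrite in_itv/= => /andP[t1 t2].
have AB : A <= 4 * B.
  have bB : `|b| <= B by rewrite /B le_max lexx.
  have rB : r <= B by rewrite /B le_max lexx orbT.
  rewrite /A ge_max; apply/andP; split; last lra.
  have h1 : `|a| <= `|a + t * b| + `|t * b|.
    have := ler_normB (a + t * b) (t * b); by rewrite addrK.
  have h2 : `|t * b| <= 2 * `|b|.
    by rewrite normrM ler_wpM2r// gtr0_norm; lra.
  lra.
have HB : (mu X <= (4 * r * B^-1)%:E)%E.
  have [rb|br] := leP `|b| r.
    have -> : B = r by apply/max_idPr.
    apply: (@le_trans _ _ (mu (`]1, 2[%classic : set R))).
      by apply: le_measure; rewrite ?inE//; exact: subIsetr.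
    rewrite lebesgue_measure_itv/= lte_fin ltr1n/= -EFinD lee_fin -mulrA mulfV ?gt_eqF//; lra.
  have -> : B = `|b| by apply/max_idPl/ltW.
  have b0 : 0 < `|b| by exact: lt_trans br.
  have bn0 : b != 0 by rewrite -normr_gt0.
  apply: (@le_trans _ _ (mu (ball (- a / b) (2 * r / `|b|)))).
    apply: le_measure; rewrite ?inE//; first exact: measurable_ball.
    move=> u [/= Hu _]; rewrite -ball_normE/= ltr_pdivlMr// -normrM.
    suff -> : (- a / b - u) * b = - (a + u * b) by rewrite normrN.
    by field.
  rewrite lebesgue_measure_ball; last by rewrite divr_ge0 ?mulr_ge0// ltW.
  rewrite lee_fin mulr2n; lra.
apply: (le_trans HB); rewrite lee_fin (invr_powR_split B0 abe1).
rewrite (_ : 16 * r * _ * _ = 4 * r * (4 * (A `^ al)^-1 * (B `^ be)^-1)); last ring.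
apply: ler_wpM2l; first by rewrite mulr_ge0 ?ltW.
apply: ler_wpM2r; first by rewrite invr_ge0 powR_ge0.
rewrite -[leRHS]invrK invfM invrK lef_pV2 ?posrE ?mulr_gt0 ?invr_gt0 ?powR_gt0//.
rewrite mulrC ler_pdivrMr// mulrC.
apply: (@le_trans _ _ ((4 * B) `^ al)).
  by apply: ge0_ler_powR; rewrite ?nnegrE// ?mulr_ge0// ltW.
rewrite powRM ?(ltW B0)//; apply: ler_wpM2r; first exact: powR_ge0.
by rewrite -[leRHS]powRr1//; apply: ler_powR; lra.
Qed.

End transversality.

(** * Projections of finite-energy clouds of points *)

Section closure_of_range.
Context {R : realType}.
Local Notation mu := (@lebesgue_measure R).

(** Writing the closure of a countable set as a decreasing intersection of
    open sets gives both the continuity from above of its measure and its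
    measurability with respect to parameters. *)
Lemma closure_rangeE (I : Type) (z : I -> R) :
  closure (range z) =
  \bigcap_k \bigcup_i [set v | `|v - z i| < k.+1%:R^-1].
Proof.
apply/seteqP; split => [v vz k _|v vz B /nbhs_ballP[e /= e0 eB]].
  have [_ [[i _ <-]]] := vz _ (nbhsx_ballx v (k.+1%:R^-1) ltac:(by [])).
  by rewrite -ball_normE/= => ?; exists i.
have [k ke] : exists k : nat, k.+1%:R^-1 < e.
  have [k _ /(_ _ (leqnn k))] := near_infty_natSinv_lt (PosNum e0).
  by exists k.
have [i _ /= iv] := vz k Logic.I.
exists (z i); split; first by exists i.
by apply: eB; rewrite -ball_normE/= (lt_trans iv).
Qed.

Lemma measurable_nearby (I : countType) (z : I -> R) (e : R) :
  measurable (\bigcup_i [set v | `|v - z i| < e] : set (measurableTypeR R)).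
Proof.
apply: countable_bigcupT_measurable => // i.
have := measurable_ball (z i) e; rewrite -ball_normE/=; congr (measurable _).
by apply/seteqP; split => v /=; rewrite distrC.
Qed.

(** The bound of [second_moment] holds for every open neighbourhood of the
    range, at a scale [r n] smaller than the size of the neighbourhood, hence
    for the intersection of these neighbourhoods. *)
Lemma closure_range_measure (I : countType) (z w : I -> R) (s : nat -> seq I)
    (r : nat -> R) (L B : R) :
  0 < L -> (forall i, `|z i| <= B) -> (forall i, 0 <= w i) ->
  (forall n, \sum_(i <- s n) w i = 1) ->
  (forall n, 0 < r n) -> r n @[n --> \oo] --> 0 ->
  (forall N, exists2 n, (N <= n)%N &
    \sum_(i <- s n) \sum_(j <- s n)
      w i * w j * (`|z i - z j| < 2 * r n)%R%:R <= 2 * r n * L) ->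
  (L^-1%:E <= mu (closure (range z)))%E.
Proof.
move=> L0 zB w0 w1 r0 rcvg HQ; rewrite closure_rangeE.
pose U k : set (measurableTypeR R) :=
  \bigcup_i [set v | `|v - z i| < k.+1%:R^-1].
have mU k : measurable (U k) by exact: measurable_nearby.
rewrite -[\bigcap_ _ _]/(\bigcap_k U k).
have U0 : (mu (U 0%N) < +oo)%E.
  apply: (@le_lt_trans _ _ (mu (ball 0 (B + 1)))).
    apply: le_measure; rewrite ?inE//; first exact: measurable_ball.
    move=> v [i _ /=]; rewrite invr1 => vz.
    rewrite -ball_normE/= sub0r normrN.
    have := ler_normD (v - z i) (z i); rewrite subrK => h.
    by have := zB i; lra.
  have [B1|B1] := leP 0 (B + 1); first by rewrite lebesgue_measure_ball// ltry.
  by rewrite (ball0 _ _).2 ?measure0// ltW.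
have Ucvg : mu \o U @ \oo --> mu (\bigcap_k U k).
  apply: nonincreasing_cvg_mu => //; first exact: bigcapT_measurable.
  move=> k l kl; apply/subsetPset => v [i _ /= vi]; exists i => //=.
  by rewrite (lt_le_trans vi)// lef_pV2 ?posrE// ler_nat.
apply: (cvge_to_ge Ucvg); apply: nearW => k /=.
have [N _ HN] : \forall n \near \oo, r n < k.+1%:R^-1.
  have /cvgrPdist_lt/(_ k.+1%:R^-1) := rcvg.
  move=> /(_ ltac:(by [])); apply: filterS => n.
  by rewrite sub0r normrN gtr0_norm.
have [n Nn Hn] := HQ N.
apply: (second_moment (r0 n) L0 w0 (w1 n) (mU k)) Hn.
move=> i v; rewrite -ball_normE/= => vi; exists i => //=.
by rewrite distrC (lt_trans vi)// HN.
Qed.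

End closure_of_range.

Section marstrand.
Context {R : realType}.
Local Notation mu := (@lebesgue_measure R).

(** The Riesz energy of exponent [a] of the discrete measure with masses [w] at
    the points [x], with the kernel truncated at scale [r]. *)
Definition energy (I : Type) (s : seq I) (w x : I -> R) (a r : R) : R :=
  \sum_(i <- s) \sum_(j <- s) w i * w j * ((Num.max `|x i - x j| r) `^ a)^-1.

(** Marstrand's projection theorem for products, along the directions
    [(1, t)].  Up to a constant, the second moment of [x + t * y] at scale
    [r n] has, by [strip_measure_le], an integral over [t] bounded by the
    product of the two energies.  By Fatou's lemma its lower limit is finite
    for almost every [t], and [closure_range_measure] applies to these [t]. *)
Lemma marstrand (I J : countType) (w x : I -> R) (w' y : J -> R)
    (s : nat -> seq I) (s' : nat -> seq J) (r : nat -> R) (al be M B : R) :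
  0 <= al -> 0 <= be -> al + be = 1 ->
  (forall i, 0 <= w i) -> (forall i, 0 <= w' i) ->
  (forall n, \sum_(i <- s n) w i = 1) -> (forall n, \sum_(i <- s' n) w' i = 1) ->
  (forall i, `|x i| <= B) -> (forall j, `|y j| <= B) ->
  (forall n, 0 < r n) -> r n @[n --> \oo] --> 0 ->
  (forall n, energy (s n) w x al (r n) <= M) ->
  (forall n, energy (s' n) w' y be (r n) <= M) ->
  mu.-negligible [set t : R | 1 < t < 2 /\
    mu (closure (range (fun ij : I * J => x ij.1 + t * y ij.2))) = 0%E].
Proof.
move=> al0 be0 abe1 w0 w0' w1 w1' xB yB r0 rcvg E E'.
pose D : set (measurableTypeR R) := `]1, 2[%classic.
have mD : measurable D by exact: measurable_itv.
pose z t (ij : I * J) := x ij.1 + t * y ij.2.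
pose om (ij : I * J) := w ij.1 * w' ij.2.
pose P n := [seq (i, j) | i <- s n, j <- s' n].
have om0 ij : 0 <= om ij by exact: mulr_ge0.
have om1 n : \sum_(ij <- P n) om ij = 1.
  rewrite big_allpairs/= -[RHS](w1 n); apply: eq_bigr => i _.
  by rewrite /om/= -mulr_sumr w1' mulr1.
pose Q n t := \sum_(a <- P n) \sum_(b <- P n)
  om a * om b * (`|z t a - z t b| < 2 * r n)%R%:R.
pose PP n := [seq (a, b) | a <- P n, b <- P n].
pose cf n (ab : (I * J) * (I * J)) := (2 * r n)^-1 * (om ab.1 * om ab.2).
pose A n (ab : (I * J) * (I * J)) : set (measurableTypeR R) :=
  [set t | `|(x ab.1.1 - x ab.2.1) + t * (y ab.1.2 - y ab.2.2)| < 2 * r n].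
pose Phi n t := (2 * r n)^-1 * Q n t.
have PhiE n t : Phi n t = \sum_(ab <- PP n) cf n ab * \1_(A n ab) t.
  rewrite /Phi /Q /PP [RHS]big_allpairs/= mulr_sumr; apply: eq_bigr => a _.
  rewrite mulr_sumr; apply: eq_bigr => b _; rewrite /cf/= indicE -!mulrA.
  suff -> : (t \in A n (a, b)) = (`|z t a - z t b| < 2 * r n) by [].
  rewrite (_ : z t a - z t b = (x a.1 - x b.1 + t * (y a.2 - y b.2))).
    by apply/idP/idP; rewrite inE.
  by rewrite /z; ring.
have cf0 n ab : 0 <= cf n ab.
  by rewrite /cf !mulr_ge0// invr_ge0 mulr_ge0// ltW.
have mA n ab : measurable (A n ab) by exact: measurable_strip.
have mPhi n : measurable_fun D (fun t => (Phi n t)%:E).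
  apply/measurable_EFinP.
  rewrite (_ : Phi n = (fun t => \sum_(ab <- PP n) cf n ab * \1_(A n ab) t)).
    by apply: measurable_sum => i; apply: measurable_funM.
  by apply/funext => t; exact: PhiE.
have Phi0 n t : 0 <= Phi n t.
  by rewrite PhiE sumr_ge0// => i _; rewrite mulr_ge0.
have iPhi n : (\int[mu]_(t in D) (Phi n t)%:E <= (8 * (M * M))%:E)%E.
  under eq_integral do rewrite PhiE.
  rewrite integral_sum_indic//.
  pose g i k := ((Num.max `|x i - x k| (r n)) `^ al)^-1.
  pose h j l := ((Num.max `|y j - y l| (r n)) `^ be)^-1.
  apply: (@le_trans _ _ (\sum_(ab <- PP n) (cf n ab *
     (16 * r n * g ab.1.1 ab.2.1 * h ab.1.2 ab.2.2))%:E)%E).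
    apply: lee_sum => ab _; rewrite (EFinM (cf n ab)).
    by apply: lee_wpmul2l; [rewrite lee_fin|exact: strip_measure_le].
  rewrite sumEFin lee_fin.
  have -> : \sum_(ab <- PP n) (cf n ab *
     (16 * r n * g ab.1.1 ab.2.1 * h ab.1.2 ab.2.2)) =
     8 * (energy (s n) w x al (r n) * energy (s' n) w' y be (r n)).
    rewrite /PP big_allpairs/= big_allpairs/= /energy mulr_suml mulr_sumr.
    apply: eq_bigr => i _; rewrite mulr_suml mulr_sumr exchange_big/=.
    rewrite big_allpairs/=; apply: eq_bigr => k _.
    rewrite mulr_sumr mulr_sumr exchange_big/=; apply: eq_bigr => j _.
    rewrite mulr_sumr mulr_sumr; apply: eq_bigr => l _.
    rewrite /cf /om /g /h/=; field.
    by rewrite !gt_eqF ?powR_gt0// lt_max r0 orbT.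
  rewrite ler_pM2l//; apply: ler_pM => //;
    apply: sumr_ge0 => i _; apply: sumr_ge0 => j _;
    by rewrite !mulr_ge0// invr_ge0 powR_ge0.
pose F t := limn_einf (fun n => (Phi n t)%:E).
have mF : measurable_fun D F.
  rewrite /F /limn_einf; apply: measurableT_comp => //.
  apply: (@measurable_fun_limn_esup _ _ _ _ (fun k t => (- (Phi k t)%:E)%E)) => k.
  by apply: (@measurableT_comp _ _ _ _ _ _ (-%E)) => //; exact: mPhi.
have F0 t : (0 <= F t)%E.
  rewrite /F limn_einf_lim; apply: lime_ge; first exact: is_cvg_einfs.
  apply: nearW => n; apply: le_ereal_inf_tmp => _ [k _ <-].
  by rewrite lee_fin.
have iF : (\int[mu]_(t in D) F t < +oo)%E.
  apply: (@le_lt_trans _ _ (limn_einf (fun n => \int[mu]_(t in D) (Phi n t)%:E)%E)).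
    by apply: fatou => // n t _; rewrite lee_fin.
  apply: (@le_lt_trans _ _ (8 * (M * M))%:E); last by rewrite ltry.
  rewrite limn_einf_lim; apply: lime_le; first exact: is_cvg_einfs.
  apply: nearW => n; apply: (le_trans _ (iPhi n)).
  by apply: ereal_inf_lbound; exists n => //=.
have : mu.-integrable D F.
  apply/integrableP; split => //.
  by under eq_integral do rewrite gee0_abs//.
move=> /integrable_ae => /(_ ltac:(by [])).
apply: negligibleS => t /= [Dt mu0] Hfin.
have Ft : F t \is a fin_num by apply: Hfin; rewrite /D/= in_itv.
pose L := fine (F t) + 1.
have L0 : 0 < L by rewrite ltr_wpDl// fine_ge0.
have : (L^-1%:E <= mu (closure (range (z t))))%E.
  apply: (@closure_range_measure _ _ (z t) om P r L (B + 2 * B)) => //.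
    move=> ij; rewrite (le_trans (ler_normD _ _))// lerD// normrM.
    apply: ler_pM => //; move: Dt => /andP[t1 t2].
    by rewrite gtr0_norm; lra.
  move=> N.
  have : (einfs (fun n => (Phi n t)%:E) N < L%:E)%E.
    apply: (@le_lt_trans _ _ (F t)).
      rewrite /F limn_einf_lim.
      have := @cvg_lim _ _ _ _ _ _ _ (@cvg_einfs_sup _ (fun n => (Phi n t)%:E)).
      move=> /(_ (@ereal_hausdorff _)) ->.
      by apply: ereal_sup_ubound; exists N.
    by rewrite -(fineK Ft) lte_fin ltrDl.
  move=> /ereal_inf_lt[_ [n /= Nn <-]]; rewrite lte_fin => /ltW HL.
  exists n => //; move: HL; rewrite /Phi mulrC ler_pdivrMr ?mulr_gt0//.
  by rewrite mulrC.
by rewrite /z mu0 lee_fin invr_le0 leNgt L0.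
Qed.

End marstrand.

(** * Null sets in products and tuples *)

Section product_null.
Context d1 d2 (T1 : measurableType d1) (T2 : measurableType d2) (R : realType).

Lemma product_measure_null (m1 : {measure set T1 -> \bar R})
    (m2 : {sigma_finite_measure set T2 -> \bar R}) (A : set (T1 * T2)) :
  measurable A ->
  (m1 \x m2)%E A = 0%E <-> {ae m1, forall x, m2 (xsection A x) = 0%E}.
Proof.
move=> mA.
have mphi := measurable_fun_xsection m2 mA.
have -> : (m1 \x m2)%E A = (\int[m1]_x `|(m2 \o xsection A) x|)%E.
  by apply: eq_integral => x _ /=; rewrite gee0_abs.
rewrite (ae_eq_integral_abs _ measurableT mphi); split.
  by apply: filterS => x /= /(_ Logic.I).
by apply: filterS => x /= ->.
Qed.

Lemma product_measure_ysection_null (m1 : {sigma_finite_measure set T1 -> \bar R})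
    (m2 : {sigma_finite_measure set T2 -> \bar R}) (A : set (T1 * T2)) :
  measurable A -> (forall y, m1 (ysection A y) = 0%E) ->
  {ae m1, forall x, m2 (xsection A x) = 0%E}.
Proof.
move=> mA A0; apply/product_measure_null => //.
have := indic_fubini_tonelli m1 m2 mA.
rewrite indic_fubini_tonelli_FE// indic_fubini_tonelli_GE//.
rewrite -[LHS]/((m1 \x m2)%E A) => ->.
by apply: integral0_eq => y _ /=; exact: A0.
Qed.

Lemma product_measure_preimage_null (m1 : {measure set T1 -> \bar R})
    (m2 : {sigma_finite_measure set T2 -> \bar R})
    (f : T1 -> T1) (g : T2 -> T2) (A : set (T1 * T2)) :
  measurable_fun setT f -> measurable_fun setT g ->
  (forall B, measurable B -> m1 B = 0%E -> m1 (f @^-1` B) = 0%E) ->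
  (forall B, measurable B -> m2 B = 0%E -> m2 (g @^-1` B) = 0%E) ->
  measurable A -> (m1 \x m2)%E A = 0%E ->
  (m1 \x m2)%E [set xy | A (f xy.1, g xy.2)] = 0%E.
Proof.
move=> mf mg f0 g0 mA A0.
have mfg : measurable [set xy | A (f xy.1, g xy.2)].
  rewrite -[X in measurable X]setTI.
  have : measurable_fun setT (fun xy : T1 * T2 => (f xy.1, g xy.2)).
    by apply/measurable_fun_pair; exact: measurableT_comp.
  exact.
apply/product_measure_null => //.
have [Z [mZ Z0 AZ]] := (product_measure_null m1 m2 mA).1 A0.
exists (f @^-1` Z); split.
- by rewrite -[X in measurable X]setTI; exact: mf.
- exact: f0.
- move=> x /= xA; apply: AZ => /= xA0; apply: xA.
  rewrite (_ : xsection _ x = g @^-1` xsection A (f x)).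
    by apply: g0 => //; exact: measurable_xsection.
  by apply/seteqP; split => y; rewrite /xsection/= !inE.
Qed.

End product_null.

Section scaling_null.
Context {R : realType}.
Local Notation mR := (measurableTypeR R).

(** Both sides are measures that agree on half-open intervals. *)
Lemma lebesgue_measure_scale (c : R) (A : set mR) : 0 < c -> measurable A ->
  lebesgue_measure A = (c%:E * lebesgue_measure [set x : R | A (c * x)%R])%E.
Proof.
move=> c0 mA.
have mc : measurable_fun setT (fun x : mR => (c * x : mR)).
  exact: measurable_funM.
have H := @lebesgue_measure_unique R
  (mscale (NngNum (ltW c0))
    (measure_function_pushforward__canonical__measure_function_Measure
       (@lebesgue_measure R) mc)).
apply: (H _ A mA) => _ [[a b] _ <-] /=.
rewrite /mscale/= /pushforward.
rewrite (_ : _ @^-1` _ = `]a / c, b / c]%classic); last first.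
  apply/seteqP; split => x /=; rewrite !in_itv/=;
    by rewrite ltr_pdivrMr// ler_pdivlMr// (mulrC x).
rewrite !lebesgue_measure_itv/= !lte_fin ltr_pM2r ?invr_gt0//.
case: ifPn => _; last by rewrite mule0.
by rewrite -!EFinD -EFinM; congr EFin; field; rewrite gt_eqF.
Qed.

Lemma lebesgue_measure_scale_null (c : R) (A : set mR) : 0 < c ->
  measurable A -> lebesgue_measure A = 0%E ->
  lebesgue_measure [set x : R | A (c * x)] = 0%E.
Proof.
move=> c0 mA; rewrite (lebesgue_measure_scale c0 mA) => /eqP.
by rewrite mule_eq0 eqe gt_eqF//= => /eqP.
Qed.

Definition tuple_scale n (c : 'I_n -> R) (t : n.-tuple mR) : n.-tuple mR :=
  [tuple c i * tnth t i | i < n].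

Lemma measurable_tuple_scale n (c : 'I_n -> R) :
  measurable_fun setT (tuple_scale c).
Proof.
apply/measurable_fun_tnthP => i.
rewrite (_ : _ \o _ = fun t : n.-tuple mR => c i * tnth t i).
  by apply: measurable_funM => //; exact: measurable_tnth.
by apply/funext => t /=; rewrite tnth_mktuple.
Qed.

Lemma lebesgue_tuple_scale_null n (c : 'I_n -> R) (A : set (n.-tuple mR)) :
  (forall i, 0 < c i) -> measurable A -> lebesgue_tuple n A = 0%E ->
  lebesgue_tuple n (tuple_scale c @^-1` A) = 0%E.
Proof.
elim: n c A => [|n ih] c A c0 mA.
  rewrite (_ : tuple_scale c @^-1` A = A)//.
  by rewrite (_ : tuple_scale c = id) ?preimage_id//; apply/funext => t; rewrite [RHS]tuple0 tuple0.
rewrite /= /lebesgue_tuple_succ /pushforward => A0.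
pose B := @tuple_cons R n @^-1` A.
have mB : measurable B.
  by rewrite -[X in measurable X]setTI; exact: measurable_tuple_cons.
have := @product_measure_preimage_null _ _ _ _ _ lebesgue_measure
  (lebesgue_tuple n) (fun x : mR => (c ord0 * x : mR))
  (tuple_scale (fun i => c (lift ord0 i))) B _ _ _ _ mB A0.
rewrite (_ : [set xy | _] = tuple_cons (n:=n) @^-1` (tuple_scale c @^-1` A)).
  apply.
  - exact: measurable_funM.
  - exact: measurable_tuple_scale.
  - by move=> C mC C0; exact: lebesgue_measure_scale_null.
  - by move=> C mC C0; exact: ih.
have E x t : tuple_cons (c ord0 * x : mR, tuple_scale (fun i => c (lift ord0 i)) t)
    = tuple_scale c (tuple_cons (x, t)).
  apply: eq_from_tnth => i; rewrite tnth_mktuple.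
  by case: (unliftP ord0 i) => [j ->|->//]; rewrite !tnthS tnth_mktuple.
by apply/seteqP; split => -[x t]; rewrite /B/= E.
Qed.

(** By Tonelli's theorem the preimage of [N] under [tuple_scale (c t)] is null
    for almost every [t], in particular for one of them; the inverse of
    this scaling preserves null sets. *)
Lemma null_of_null_on_curves n (c : R -> 'I_n -> R) (N : set (n.-tuple mR)) :
  (forall t i, 1 < t < 2 -> 0 < c t i) ->
  (forall i, measurable_fun [set: mR] (c^~ i)) ->
  measurable N ->
  (forall q, lebesgue_measure.-negligible
     [set t : R | 1 < t < 2 /\ N (tuple_scale (c t) q)]) ->
  lebesgue_tuple n N = 0%E.
Proof.
move=> c0 mc mN Nq.
pose S (tq : mR * n.-tuple mR) : n.-tuple mR := tuple_scale (c tq.1) tq.2.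
have mS : measurable_fun setT S.
  apply/measurable_fun_tnthP => i.
  rewrite (_ : _ \o _ = fun tq : mR * n.-tuple mR => c tq.1 i * tnth tq.2 i).
    apply: measurable_funM; first exact: (measurableT_comp (mc i)).
    exact: (measurableT_comp (measurable_tnth i)).
  by apply/funext => t /=; rewrite tnth_mktuple.
pose G : set (mR * n.-tuple mR) := (`]1, 2[%classic `*` setT) `&` S @^-1` N.
have mG : measurable G.
  apply: measurableI; first by apply: measurableX => //; exact: measurable_itv.
  by rewrite -[X in measurable X]setTI; exact: mS.
have : {ae lebesgue_measure, forall t, lebesgue_tuple n (xsection G t) = 0%E}.
  apply: product_measure_ysection_null => // q.
  apply/negligibleP; first exact: measurable_ysection.
  apply: negligibleS (Nq q) => t; rewrite /ysection/= inE /G/= in_itv/=.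
  by move=> [[]].
move=> [Z [mZ Z0 GZ]].
have [t t12 Gt] : exists2 t : R, 1 < t < 2 & lebesgue_tuple n (xsection G t) = 0%E.
  apply: contrapT => H.
  have : (lebesgue_measure (`]1%R, 2%R[%classic : set R) <= 0)%E.
    rewrite -[X in (_ <= X)%E]Z0; apply: le_measure; rewrite ?inE//.
    move=> t /=; rewrite in_itv/= => t12; apply: GZ => /= Gt.
    by apply: H; exists t.
  by rewrite lebesgue_measure_itv/= lte_fin ltr1n/= -EFinD lee_fin; lra.
have SK : cancel (tuple_scale (fun i => (c t i)^-1)) (tuple_scale (c t)).
  move=> q; apply: eq_from_tnth => i; rewrite !tnth_mktuple mulrA mulfV ?mul1r//.
  by rewrite gt_eqF// c0.
have -> : N = tuple_scale (fun i => (c t i)^-1) @^-1` (xsection G t).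
  apply/seteqP; split => q; rewrite /xsection/= inE /G/S/= in_itv/= SK//.
  by move=> [].
apply: lebesgue_tuple_scale_null => //; last exact: measurable_xsection.
by move=> i; rewrite invr_gt0 c0.
Qed.

End scaling_null.

(** * Energy of self-similar clouds *)

Section words.
Context {R : realType} (m : nat).
Implicit Types (p : (m + m).-tuple R) (u v : seq 'I_m) (w : 'I_m -> R).

Fixpoint words (n : nat) : seq (seq 'I_m) :=
  match n with
  | 0 => [:: [::]]
  | n'.+1 => [seq k :: u | k <- index_enum 'I_m, u <- words n']
  end.

Lemma big_wordsS n (F : seq 'I_m -> R) :
  \sum_(u <- words n.+1) F u = \sum_k \sum_(u <- words n) F (k :: u).
Proof. by rewrite /= big_allpairs_dep. Qed.

Definition word_map p u (x : R) : R := foldr (affine_map p) x u.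

Definition word_weight w u : R := \prod_(k <- u) w k.

Lemma word_weight_ge0 w u : (forall k, 0 <= w k) -> 0 <= word_weight w u.
Proof. by move=> w0; apply: prodr_ge0. Qed.

Lemma sum_word_weight w n :
  \sum_(u <- words n) word_weight w u = (\sum_k w k) ^+ n.
Proof.
elim: n => [|n ih]; first by rewrite big_seq1 /word_weight big_nil expr0.
rewrite big_wordsS exprS -ih mulr_suml; apply: eq_bigr => k _.
by rewrite mulr_sumr; apply: eq_bigr => u _; rewrite /word_weight big_cons.
Qed.

Definition ratio_sum p (a : R) : R := \sum_k `|ratio p k| `^ a.

(** The weights are normalized powers of the ratios with the exponent [a] of
    the energy instead of the similarity dimension, so that the
    recursion for the energy has the contraction factor
    [(ratio_sum p a)^-1]. *)
Definition gibbs p a k : R := `|ratio p k| `^ a / ratio_sum p a.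

(** Splitting pairs of words according to their first letters gives a recursion
    in the length of the words.  Pairs with distinct first letters are
    [delta]-separated and contribute at most [(delta `^ a)^-1].  Pairs with the same
    first letter [k] contribute [gibbs p a k ^+ 2 * (`|ratio p k| `^ a)^-1],
    that is, [gibbs p a k / ratio_sum p a], times the energy of shorter words at
    the larger scale [r / `|ratio p k|].  Since [1 < ratio_sum p a], the
    recursion is contracting. *)
Lemma energy_words_le p (x0 a rho delta : R) :
  0 <= a -> (forall k, 0 < `|ratio p k| <= rho) -> 0 < delta ->
  (forall k l u v, k != l ->
    delta <= `|word_map p (k :: u) x0 - word_map p (l :: v) x0|) ->
  1 < ratio_sum p a ->
  exists M, forall n r, 0 < r -> rho ^+ n <= r ->
    energy (words n) (word_weight (gibbs p a)) (word_map p ^~ x0) a r <= M.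
Proof.
move=> a0 Hrho d0 gap Z1; set Z := ratio_sum p a in Z1.
have Z0 : 0 < Z by rewrite (lt_trans _ Z1).
set w := gibbs p a.
have w0 k : 0 <= w k by rewrite divr_ge0 ?powR_ge0 ?ltW.
have w1 : \sum_k w k = 1 by rewrite /w /gibbs -mulr_suml mulfV ?gt_eqF.
have sw1 n : \sum_(u <- words n) word_weight w u = 1.
  by rewrite sum_word_weight w1 expr1n.
have W0 u : 0 <= word_weight w u by exact: word_weight_ge0.
have da0 : 0 < delta `^ a by exact: powR_gt0.
have Zi0 : 0 <= Z^-1 by rewrite invr_ge0 ltW.
have Zi1 : 0 < 1 - Z^-1 by rewrite subr_gt0 invf_lt1.
(* The bound has to hold for the empty word and to be stable under the
   recursion e -> (delta `^ a)^-1 + Z^-1 * e. *)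
pose M := Num.max 1 ((delta `^ a)^-1 / (1 - Z^-1)).
have M1 : 1 <= M by rewrite /M le_max lexx.
have HM : (delta `^ a)^-1 + Z^-1 * M <= M.
  have : (delta `^ a)^-1 / (1 - Z^-1) <= M by rewrite /M le_max lexx orbT.
  rewrite ler_pdivrMr// mulrBr mulr1; lra.
exists M; elim=> [|n ih] r r0 Hr.
  rewrite /energy !big_seq1 /word_weight big_nil !mul1r subrr normr0.
  rewrite (max_idPr _) ?(ltW r0)//; apply: le_trans M1.
  rewrite invf_le1 ?powR_gt0//; move: Hr; rewrite expr0 => r1.
  by rewrite -[leLHS](powRr0 r) ler_powR.
apply: le_trans HM; rewrite /energy big_wordsS.
under eq_bigr do under eq_bigr do rewrite big_wordsS.
rewrite (_ : (delta `^ a)^-1 + _ = \sum_k \sum_l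
   (w k * w l * (delta `^ a)^-1 + (k == l)%:R * (w k * Z^-1 * M))); last first.
  under eq_bigr do rewrite big_split/= -mulr_suml -mulr_sumr w1 mulr1.
  rewrite big_split/= -mulr_suml w1 mul1r; congr (_ + _).
  under eq_bigr => k _.
    rewrite (bigD1 k)//= eqxx mul1r big1 ?addr0; last first.
      by move=> l lk; rewrite eq_sym (negbTE lk) mul0r.
    over.
  by rewrite -mulr_suml -mulr_suml w1 mul1r.
apply: ler_sum => k _; rewrite exchange_big/=; apply: ler_sum => l _.
have WE i u : word_weight w (i :: u) = w i * word_weight w u.
  by rewrite /word_weight big_cons.
have [<-{l}|kl] := eqVneq k l; last first.
  rewrite mul0r addr0.
  apply: (@le_trans _ _ (\sum_(u <- words n) \sum_(v <- words n)
     (w k * w l * (delta `^ a)^-1) * (word_weight w u * word_weight w v))).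
    apply: ler_sum => u _; apply: ler_sum => v _; rewrite !WE.
    rewrite (_ : _ * (word_weight w u * _) = w k * word_weight w u *
      (w l * word_weight w v) * (delta `^ a)^-1); last ring.
    apply: ler_wpM2l; first by apply: mulr_ge0; apply: mulr_ge0.
    rewrite lef_pV2 ?posrE ?powR_gt0//; last by rewrite lt_max r0 orbT.
    apply: ge0_ler_powR => //; rewrite ?nnegrE ?(ltW d0)//.
      by rewrite le_max (ltW r0) orbT.
    by rewrite le_max gap.
  under eq_bigr do rewrite -!mulr_sumr sw1 mulr1.
  by rewrite -mulr_sumr sw1 mulr1.
have lk0 : 0 < `|ratio p k| by have /andP[] := Hrho k.
have rn0 : 0 < r / `|ratio p k| by rewrite divr_gt0.
have := ih _ rn0.
have -> : rho ^+ n <= r / `|ratio p k|.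
  rewrite ler_pdivlMr//; apply: le_trans Hr; rewrite exprSr.
  have /andP[_ lr] := Hrho k.
  apply: ler_wpM2l => //; apply: exprn_ge0; exact: le_trans lr.
move=> /(_ isT) ihk.
rewrite mul1r (_ : \sum_(_ <- _) _ = w k * Z^-1 * energy (words n)
  (word_weight w) (word_map p ^~ x0) a (r / `|ratio p k|)).
  apply: (@le_trans _ _ (w k * Z^-1 * M)).
    by apply: ler_wpM2l => //; apply: mulr_ge0.
  by rewrite lerDr; apply: mulr_ge0; [exact: mulr_ge0|rewrite invr_ge0 ltW].
rewrite /energy mulr_sumr; apply: eq_bigr => u _.
rewrite mulr_sumr; apply: eq_bigr => v _; rewrite !WE.
have -> : word_map p (k :: u) x0 - word_map p (k :: v) x0 =
    ratio p k * (word_map p u x0 - word_map p v x0).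
  by rewrite /word_map/= /affine_map; ring.
have -> : Num.max `|ratio p k * (word_map p u x0 - word_map p v x0)| r =
   `|ratio p k| * Num.max `|word_map p u x0 - word_map p v x0| (r / `|ratio p k|).
  by rewrite maxr_pMr ?normr_ge0// normrM mulrCA mulfV ?gt_eqF// mulr1.
rewrite powRM ?normr_ge0//; last by rewrite le_max (ltW rn0) orbT.
have wE : w k = `|ratio p k| `^ a / Z by [].
rewrite {2}wE; field.
by rewrite !gt_eqF// powR_gt0// lt_max rn0 orbT.
Qed.

End words.

(** * Geometry of the contractions *)

Section geometry.
Context {R : realType} (m : nat).
Implicit Types (p : (m + m).-tuple R) (u v : seq 'I_m) (x y : R).

Definition center p k : R := affine_map p k 2^-1.

Lemma affine_mapE p k x :
  affine_map p k x = center p k + ratio p k * (x - 2^-1).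
Proof. by rewrite /center /affine_map; ring. Qed.

(** In terms of midpoints and lengths of the images of the unit interval, the
    geometric conditions become inequalities between measurable functions of
    the parameters. *)
Definition disjoint_contraction p : Prop :=
  [/\ forall k, 0 < `|ratio p k| < 1,
      forall k, `|center p k - 2^-1| <= (1 - `|ratio p k|) / 2 &
      forall k l, k != l ->
        (`|ratio p k| + `|ratio p l|) / 2 < `|center p k - center p l|].

Lemma admissible_disjoint_contraction p :
  admissible p -> disjoint_contraction p.
Proof.
move=> [Hr Hin Hdis].
have r01 k : 0 < `|ratio p k| < 1.
  have := Hr k; rewrite /= !in_itv/= => -[] /andP[h1 h2].
    by rewrite ltr0_norm; lra.
  by rewrite gtr0_norm; lra.
split=> // [k|k l kl].
  have /= := Hin k (affine_map p k 0) ltac:(by exists 0; rewrite //= in_itv/=; lra).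
  have /= := Hin k (affine_map p k 1) ltac:(by exists 1; rewrite //= in_itv/=; lra).
  rewrite /center /affine_map !in_itv/= => /andP[h1 h2] /andP[h3 h4].
  by rewrite ler_norml; case: (ler0P (ratio p k)) => h; apply/andP; split; lra.
rewrite ltNge; apply/negP => Hle.
have /andP[k0 _] := r01 k; have /andP[l0 _] := r01 l.
set s := `|ratio p k| + `|ratio p l| in Hle.
have s0 : 0 < s by exact: addr_gt0.
(* If the midpoints are too close, then the point dividing the segment
   between them in proportion to the lengths belongs to both images; x and y
   are its preimages. *)
pose e := (center p l - center p k) / s.
have e2 : `|e| <= 2^-1.
  by rewrite /e normrM distrC normfV (gtr0_norm s0) ler_pdivrMr// mulrC.
have kn0 : ratio p k != 0 by rewrite -normr_gt0.
have ln0 : ratio p l != 0 by rewrite -normr_gt0.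
pose x := 2^-1 + e * `|ratio p k| / ratio p k.
pose y := 2^-1 - e * `|ratio p l| / ratio p l.
have in01 i c : `|c| <= 2^-1 ->
    2^-1 + c * `|ratio p i| / ratio p i \in `[0, 1].
  move=> c2; rewrite in_itv/=.
  have : `|c * `|ratio p i| / ratio p i| <= 2^-1.
    rewrite !normrM normr_id normfV -mulrA mulfV ?mulr1//.
    by have /andP[/gt_eqF -> _] := r01 i.
  by rewrite ler_norml => /andP[h1 h2]; apply/andP; split; lra.
have xy : affine_map p k x = affine_map p l y.
  rewrite !affine_mapE /x /y.
  have -> : center p l = center p k + e * s by rewrite /e divfK ?gt_eqF//; ring.
  by rewrite /s; field; rewrite kn0 ln0.
have : (affine_map p k @` `[0, 1] `&` affine_map p l @` `[0, 1])
    (affine_map p k x).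
  split; first by exists x => //; exact: in01.
  exists y => //; rewrite /y -2!mulNr; apply: in01; by rewrite normrN.
by rewrite Hdis.
Qed.

Section contraction.
Variables (p : (m + m).-tuple R).
Hypothesis dp : disjoint_contraction p.

Lemma affine_map_itv k x : 0 <= x <= 1 -> 0 <= affine_map p k x <= 1.
Proof.
move=> /andP[x0 x1]; have [_ /(_ k) Hc _] := dp.
rewrite affine_mapE.
have Hx : `|ratio p k * (x - 2^-1)| <= `|ratio p k| / 2.
  by rewrite normrM ler_wpM2l// ler_norml; apply/andP; split; lra.
move: Hc Hx; rewrite !ler_norml => /andP[h1 h2] /andP[h3 h4].
by apply/andP; split; lra.
Qed.

Lemma word_map_itv u x : 0 <= x <= 1 -> 0 <= word_map p u x <= 1.
Proof. by move=> x01; elim: u => //= k u ih; exact: affine_map_itv. Qed.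

(** The distance between distinct images is at least the distance of the
    midpoints minus the half-lengths, and there are finitely many pairs of
    images. *)
Lemma affine_map_gap : exists2 delta, 0 < delta & forall k l x y, k != l ->
  0 <= x <= 1 -> 0 <= y <= 1 -> delta <= `|affine_map p k x - affine_map p l y|.
Proof.
have [_ _ H] := dp.
pose g (kl : 'I_m * 'I_m) :=
  `|center p kl.1 - center p kl.2| - (`|ratio p kl.1| + `|ratio p kl.2|) / 2.
exists (\big[Num.min/1]_(kl | kl.1 != kl.2) g kl).
  by apply/bigmin_gtP; split => // -[k l] /= kl; rewrite /g/= subr_gt0 H.
move=> k l x y kl /andP[x0 x1] /andP[y0 y1].
apply: (@le_trans _ _ (g (k, l))); first exact: bigmin_le_cond.
rewrite /g/= !affine_mapE.
have Hb i z : 0 <= z -> z <= 1 -> `|ratio p i * (z - 2^-1)| <= `|ratio p i| / 2.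
  by move=> z0 z1; rewrite normrM ler_wpM2l// ler_norml; apply/andP; split; lra.
have := Hb k x x0 x1; have := Hb l y y0 y1.
set a := ratio p k * _; set b := ratio p l * _ => hb ha.
have h1 := ler_distD (center p k + a) (center p k) (center p l).
have h2 := ler_distD (center p l + b) (center p k + a) (center p l).
have e1 : `|center p k - (center p k + a)| = `|a|.
  by rewrite opprD addrA subrr add0r normrN.
have e2 : `|center p l + b - center p l| = `|b| by rewrite addrAC subrr add0r.
rewrite e1 in h1; rewrite e2 in h2; lra.
Qed.

Lemma ratio_bound : exists2 rho, 0 < rho < 1 & forall k, 0 < `|ratio p k| <= rho.
Proof.
have [H _ _] := dp.
exists (\big[Num.max/2^-1]_k `|ratio p k|).
  apply/andP; split.
    by apply: lt_le_trans (bigmax_ge_id _ _ _ _); rewrite invr_gt0.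
  by apply/bigmax_ltP; split; [lra|move=> k _; have /andP[] := H k].
move=> k; have /andP[-> _] /= := H k; exact: le_bigmax.
Qed.

End contraction.

Variable k0 : 'I_m.

Definition fixed_point p : R := translation p k0 / (1 - ratio p k0).

Lemma fixed_pointE p : disjoint_contraction p ->
  affine_map p k0 (fixed_point p) = fixed_point p.
Proof.
move=> [/(_ k0)/andP[_ r1] _ _]; rewrite /affine_map /fixed_point.
have : ratio p k0 < 1 by exact: le_lt_trans (ler_norm _) r1.
by move=> h; field; lra.
Qed.

Lemma fixed_point_itv p : disjoint_contraction p -> 0 <= fixed_point p <= 1.
Proof.
move=> dp; have [/(_ k0)/andP[_ r1] /(_ k0) Hc _] := dp.
move: Hc r1; rewrite /fixed_point /center /affine_map => Hc r1.
have r1' : ratio p k0 < 1 by exact: le_lt_trans (ler_norm _) r1.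
have h := ler_norm (ratio p k0).
move: Hc; rewrite ler_norml => /andP[h1 h2].
by rewrite divr_ge0 ?ler_pdivrMr ?mul1r ?subr_gt0//=; lra.
Qed.

(** Starting from a fixed point guarantees that all these points belong to the
    Cantor set, while they remain measurable functions of [p]. *)
Definition cylinder_point p u : R := word_map p u (fixed_point p).

Lemma cylinder_point_itv p u : disjoint_contraction p ->
  0 <= cylinder_point p u <= 1.
Proof. by move=> dp; apply: word_map_itv => //; exact: fixed_point_itv. Qed.

Lemma cylinder_point_cantor p u : disjoint_contraction p ->
  affine_cantor p (cylinder_point p u).
Proof.
move=> dp n _; elim: n u => [|n ih] u /=.
  by rewrite in_itv/=; exact: cylinder_point_itv.
case: u => [|k u].
  exists k0 => //; exists (cylinder_point p [::]); first exact: ih.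
  by rewrite /cylinder_point/= fixed_pointE.
by exists k => //; exists (cylinder_point p u).
Qed.

End geometry.

Section cantor_closed.
Context {R : realType}.

Lemma compact_bigcup_finType (I : finType) (F : I -> set R) :
  (forall i, compact (F i)) -> compact (\bigcup_(i in [set: I]) F i).
Proof.
move=> cF; rewrite bigcup_fset_set//; last exact: finite_finset.
by elim/big_ind: _ => //; [exact: compact0|exact: compactU].
Qed.

Lemma affine_cantor_compact m (p : (m + m).-tuple R) : compact (affine_cantor p).
Proof.
have cl n : compact (cantor_level p n).
  elim: n => [|n ih] /=; first exact: segment_compact.
  apply: compact_bigcup_finType => k; apply: continuous_compact => //.
  apply: continuous_subspaceT => x.
  by apply: cvgD; [apply: cvgM; [exact: cvg_cst|]|exact: cvg_cst].
apply: (subclosed_compact _ (cl 0%N)); last exact: bigcap_inf.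
apply: closed_bigI => n _; exact: compact_closed.
Qed.

Lemma sumset_closed (A B : set R) : compact A -> compact B -> closed (sumset A B).
Proof.
move=> cA cB; apply: compact_closed; first exact: Rhausdorff.
have -> : sumset A B = (fun xy : R * R => xy.1 + xy.2) @` (A `*` B).
  apply/seteqP; split => [_ [x Ax [y By <-]]|_ [[x y] [/= Ax By] <-]].
    by exists (x, y).
  by exists x => //; exists y.
apply: continuous_compact; last exact: compact_setX.
by apply: continuous_subspaceT => x; exact: add_continuous.
Qed.

Lemma closure_cylinder_points_sumset m m' (k0 : 'I_m) (k0' : 'I_m')
    (p : (m + m).-tuple R) (q : (m' + m').-tuple R) :
  disjoint_contraction p -> disjoint_contraction q ->
  closure (range (fun uv : seq 'I_m * seq 'I_m' =>
      cylinder_point k0 p uv.1 + cylinder_point k0' q uv.2)) `<=`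
  sumset (affine_cantor p) (affine_cantor q).
Proof.
move=> dp dq.
have cl : closed (sumset (affine_cantor p) (affine_cantor q)).
  by apply: sumset_closed; exact: affine_cantor_compact.
rewrite [X in _ `<=` X]((closure_id _).1 cl); apply: closureS => _ [[u v] _ <-] /=.
exists (cylinder_point k0 p u); first exact: cylinder_point_cantor.
by exists (cylinder_point k0' q v) => //; exact: cylinder_point_cantor.
Qed.

End cantor_closed.

(** * Hausdorff dimension and the sums of powers of the ratios *)

Section dimension.
Context {R : realType} (m : nat).
Implicit Types (p : (m + m).-tuple R) (u v : seq 'I_m).

Lemma mem_words n u : (u \in words m n) = (size u == n).
Proof.
elim: n u => [|n ih] [|k u] //=.
- by apply/allpairsPdep => -[? [? []]].
- apply/allpairsPdep/idP => [[l [v [_ vn [_ ->]]]]|].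
    by rewrite eqSS -ih.
  by rewrite eqSS -ih => un; exists k, u; rewrite mem_index_enum.
Qed.

Lemma word_mapB p u x y : `|word_map p u x - word_map p u y| =
  word_weight (fun k => `|ratio p k|) u * `|x - y|.
Proof.
elim: u => [|k u ih]; first by rewrite /word_weight big_nil mul1r.
rewrite /word_weight big_cons -mulrA -ih -normrM; congr Num.norm.
by rewrite /word_map/= /affine_map; ring.
Qed.

Definition cylinder p u : set R := word_map p u @` `[0, 1].

Lemma cantor_level_cylinders p n x : cantor_level p n x ->
  exists2 u, size u = n & cylinder p u x.
Proof.
elim: n x => [|n ih] x /=; first by exists [::] => //; exists x.
move=> [k _ [_ /ih[u <- [y y01 <-]] <-]].
by exists (k :: u) => //; exists y.
Qed.

Lemma diameter_cylinder p u :
  (diameter (cylinder p u) <= (word_weight (fun k => `|ratio p k|) u)%:E)%E.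
Proof.
apply: ge_ereal_sup => _ [_ [x x01 <-] [_ [y y01 <-] <-]].
rewrite lee_fin word_mapB ler_piMr ?word_weight_ge0//.
move: x01 y01; rewrite /= !in_itv/= => /andP[x0 x1] /andP[y0 y1].
by rewrite ler_norml; apply/andP; split; lra.
Qed.

Lemma diameter_pow_ge0 (a : R) U : (0 <= diameter_pow a U)%E.
Proof. by rewrite /diameter_pow; case: ifP => // _; exact: poweR_ge0. Qed.

Lemma diameter_pow_cylinder p a u : 0 <= a ->
  (diameter_pow a (cylinder p u) <=
    (word_weight (fun k => `|ratio p k| `^ a) u)%:E)%E.
Proof.
move=> a0.
have c0 : cylinder p u (word_map p u 0) by exists 0; rewrite //= in_itv/= lexx ler01.
have Ww : word_weight (fun k => `|ratio p k| `^ a) u =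
    (word_weight (fun k => `|ratio p k|) u) `^ a.
  elim: u {c0} => [|k u ih]; first by rewrite /word_weight !big_nil powR1.
  by rewrite /word_weight !big_cons powRM// ?prodr_ge0// -/(word_weight _ _) ih.
rewrite /diameter_pow ifF; last by apply/eqP => c; rewrite c in c0.
rewrite Ww -poweR_EFin; apply: gt0_ler_poweR => //.
- rewrite in_itv/= leey andbT; apply: ereal_sup_ubound.
  exists (word_map p u 0) => //; exists (word_map p u 0) => //.
  by rewrite subrr normr0.
- by rewrite in_itv/= leey andbT lee_fin word_weight_ge0.
- exact: diameter_cylinder.
Qed.

(** The images of the unit interval under the words of length [n] cover the
    Cantor set, have diameter at most [rho ^+ n], and the sum of the powers
    [a] of their diameters is at most [ratio_sum p a ^+ n]. *)
Lemma hausdorff_dim_cantor_le p (a rho : R) : 0 <= a ->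
  0 < rho < 1 -> (forall k, `|ratio p k| <= rho) -> ratio_sum p a < 1 ->
  (hausdorff_dim (affine_cantor p) <= a%:E)%E.
Proof.
move=> a0 /andP[rho0 rho1] Hrho S1.
have S0 : 0 <= ratio_sum p a by apply: sumr_ge0 => k _; exact: powR_ge0.
suff H : hausdorff_measure a (affine_cantor p) = 0%E.
  by apply: ereal_inf_lbound; exists a.
apply/eqP; rewrite eq_le; apply/andP; split; last first.
  apply: (@le_trans _ _ (hausdorff_premeasure a 1 (affine_cantor p))).
    apply: le_ereal_inf_tmp => _ [U _ <-].
    by apply: nneseries_ge0 => n _ _; exact: diameter_pow_ge0.
  by apply: ereal_sup_ubound; exists 1 => //=.
apply: ge_ereal_sup => _ [delta /= d0 <-].
apply/lee_addgt0Pr => e e0; rewrite add0e.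
have [N1 _ HN1] : \forall n \near \oo, rho ^+ n < delta.
  have /cvg_expr : `|rho| < 1 by rewrite gtr0_norm.
  move/cvgrPdist_lt => /(_ _ d0); apply: filterS => n.
  by rewrite sub0r normrN; apply: le_lt_trans; exact: ler_norm.
have [N2 _ HN2] : \forall n \near \oo, ratio_sum p a ^+ n < e.
  have /cvg_expr : `|ratio_sum p a| < 1 by rewrite ger0_norm.
  move/cvgrPdist_lt => /(_ _ e0); apply: filterS => n.
  by rewrite sub0r normrN; apply: le_lt_trans; exact: ler_norm.
pose n := maxn N1 N2.
pose cs := [seq cylinder p u | u <- words m n].
pose U i := nth set0 cs i.
have Uge i : (size cs <= i)%N -> U i = set0 by move=> ?; exact: nth_default.
apply: (@le_trans _ _ (\sum_(0 <= i <oo) diameter_pow a (U i))%E).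
  apply: ereal_inf_lbound; exists U => //; split.
    move=> i; have [ci|ic] := leqP (size cs) i.
      rewrite Uge// /diameter (_ : [set _ | _ in _ & _ in _] = set0).
        by rewrite ereal_sup0 leNye.
      by rewrite -subset0 => _ [? []].
    move: ic; rewrite size_map => ic.
    rewrite /U (nth_map [::])//; set u := nth _ _ _.
    have /eqP us : size u == n by rewrite -mem_words mem_nth.
    apply: (le_trans (diameter_cylinder _ _)); rewrite lee_fin.
    apply: (@le_trans _ _ (rho ^+ n)); last by rewrite ltW// HN1//= leq_maxl.
    rewrite -us; elim: (u) => [|k v ih]; first by rewrite /word_weight big_nil.
    by rewrite /word_weight big_cons exprS ler_pM ?word_weight_ge0.
  move=> x /(_ n Logic.I) /cantor_level_cylinders[u un ux].
  exists (index u (words m n)) => //.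
  by rewrite /U (nth_map [::]) ?nth_index ?index_mem// mem_words un.
rewrite (@nneseries_split _ _ 0 (size cs)); last first.
  by move=> k _; exact: diameter_pow_ge0.
rewrite add0n [X in (_ + X)%E]eseries0 ?adde0; last first.
  by move=> i ci _; rewrite Uge// /diameter_pow eqxx.
rewrite -(big_nth set0 xpredT (diameter_pow a)) big_map.
apply: (@le_trans _ _ (\sum_(u <- words m n)
    (word_weight (fun k => `|ratio p k| `^ a) u)%:E)%E).
  by apply: lee_sum => u _; exact: diameter_pow_cylinder.
by rewrite sumEFin sum_word_weight lee_fin ltW// HN2//= leq_maxr.
Qed.

(** Some exponent [b] larger than [a] is still below the dimension, so that
    [1 <= ratio_sum p b] by [hausdorff_dim_cantor_le], and [ratio_sum p] is
    strictly decreasing. The exponent [0] is allowed whatever the dimension, as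
    [ratio_sum p 0] is the number of maps. *)
Lemma ratio_sum_gt1 p (a rho : R) : (2 <= m)%N -> 0 <= a ->
  0 < rho < 1 -> (forall k, 0 < `|ratio p k| <= rho) ->
  a = 0 \/ (a%:E < hausdorff_dim (affine_cantor p))%E ->
  1 < ratio_sum p a.
Proof.
move=> m2 a0 rho01 Hrho [->|aD].
  rewrite /ratio_sum; under eq_bigr do rewrite powRr0.
  by rewrite sumr_const card_ord ltr1n.
have Hr k : `|ratio p k| <= rho by have /andP[] := Hrho k.
have [b ab bD] : exists2 b : R, a < b & (b%:E < hausdorff_dim (affine_cantor p))%E.
  case: (hausdorff_dim _) aD => [D| |//].
    by rewrite lte_fin => aD; exists ((a + D) / 2); rewrite ?lte_fin; lra.
  by exists (a + 1); rewrite ?ltry//; lra.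
have S1 : 1 <= ratio_sum p b.
  rewrite leNgt; apply/negP => Sb.
  have b0 : 0 <= b by rewrite (le_trans a0)// ltW.
  by have := hausdorff_dim_cantor_le b0 rho01 Hr Sb; rewrite leNgt bD.
apply: (le_lt_trans S1); rewrite /ratio_sum.
have k0 : 'I_m by case: m m2 => // n _; exact: ord0.
have lt k : `|ratio p k| `^ b < `|ratio p k| `^ a.
  have /andP[l0 lr] := Hrho k; have /andP[_ rho1] := rho01.
  rewrite -(subrK a b) powRD; last by rewrite (gt_eqF l0) implybT.
  rewrite gtr_pMl ?powR_gt0//.
  have -> : 1 = 1 `^ (b - a) :> R by rewrite powR1.
  apply: gt0_ltr_powR; rewrite ?nnegrE ?subr_gt0//.
  exact: le_lt_trans lr rho1.
rewrite (bigD1 k0)//= [ltRHS](bigD1 k0)//=.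
by apply: ltr_leD => //; apply: ler_sum => k _; exact: ltW.
Qed.

End dimension.

(** * Measurability in the parameters *)

Section measurable_parameters.
Context {R : realType}.
Local Notation mR := (measurableTypeR R).

(** The identity [x^-1 = x * (x ^+ 2) `^ (-1)] reduces inverses to powers of
    nonnegative reals. *)
Lemma measurable_invr d (T : measurableType d) (f : T -> mR) :
  measurable_fun setT f -> measurable_fun setT (fun x => (f x)^-1 : mR).
Proof.
move=> mf.
have -> : (fun x => (f x)^-1) = (fun x => f x * (f x ^+ 2) `^ (-1)) :> (T -> R).
  apply/funext => x; rewrite powR_inv1 ?sqr_ge0//.
  have [->|f0] := eqVneq (f x) 0; first by rewrite invr0 mul0r.
  by field.
apply: measurable_funM => //.
apply: (@measurableT_comp _ _ _ _ _ _ (@powR R ^~ (-1))); first exact: measurable_powR.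
exact: measurable_funX.
Qed.

Lemma measurable_lt_set d (T : measurableType d) (f g : T -> mR) :
  measurable_fun setT f -> measurable_fun setT g ->
  measurable [set x | (f x < g x)%R].
Proof.
move=> mf mg.
have := measurable_fun_ltr mf mg measurableT (Y := [set true]) Logic.I.
by rewrite setTI.
Qed.

Lemma measurable_le_set d (T : measurableType d) (f g : T -> mR) :
  measurable_fun setT f -> measurable_fun setT g ->
  measurable [set x | (f x <= g x)%R].
Proof.
move=> mf mg.
have := measurable_fun_ler mf mg measurableT (Y := [set true]) Logic.I.
by rewrite setTI.
Qed.

Lemma measurable_abs d (T : measurableType d) (f : T -> mR) :
  measurable_fun setT f -> measurable_fun setT (fun x => `|f x| : mR).
Proof. by move=> mf; exact: measurableT_comp. Qed.

Lemma measurable_forall d (T : measurableType d) (I : finType)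
    (P : I -> T -> Prop) :
  (forall i, measurable [set x | P i x]) -> measurable [set x | forall i, P i x].
Proof.
move=> mP; rewrite (_ : [set x | _] = \bigcap_(i in [set: I]) [set x | P i x]).
  by apply: fin_bigcap_measurable => //; exact: finite_finset.
by apply/seteqP; split => [x Px i _|x Px i]; exact: Px.
Qed.

Section one_tuple.
Variable m : nat.
Local Notation T := ((m + m).-tuple mR).

Lemma measurable_ratio k : measurable_fun setT (fun p : T => ratio p k : mR).
Proof. exact: measurable_tnth. Qed.

Lemma measurable_translation k :
  measurable_fun setT (fun p : T => translation p k : mR).
Proof. exact: measurable_tnth. Qed.

Lemma measurable_affine_map k (f : T -> mR) : measurable_fun setT f ->
  measurable_fun setT (fun p : T => affine_map p k (f p) : mR).
Proof.
move=> mf; apply: measurable_funD; last exact: measurable_translation.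
by apply: measurable_funM => //; exact: measurable_ratio.
Qed.

Lemma measurable_cylinder_point k0 u :
  measurable_fun setT (fun p : T => cylinder_point k0 p u : mR).
Proof.
elim: u => [|k u ih]; last exact: measurable_affine_map.
apply: measurable_funM; first exact: measurable_translation.
apply: measurable_invr; apply: measurable_funB => //; exact: measurable_ratio.
Qed.

Lemma measurable_abs_ratio k :
  measurable_fun setT (fun p : T => `|ratio p k| : mR).
Proof. by apply: measurable_abs; exact: measurable_ratio. Qed.

Lemma measurable_ratio_sum a :
  measurable_fun setT (fun p : T => ratio_sum p a : mR).
Proof.
apply: measurable_sum => k.
apply: (@measurableT_comp _ _ _ _ _ _ (@powR R ^~ a)); first exact: measurable_powR.
exact: measurable_abs_ratio.
Qed.

Lemma measurable_disjoint_contraction :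
  measurable [set p : T | disjoint_contraction p].
Proof.
have mc k : measurable_fun setT (fun p : T => center p k : mR).
  exact: measurable_affine_map.
rewrite (_ : [set p | _] = [set p : T | forall k, 0 < `|ratio p k|] `&`
    [set p : T | forall k, `|ratio p k| < 1] `&`
    [set p : T | forall k, `|center p k - 2^-1| <= (1 - `|ratio p k|) / 2] `&`
    [set p : T | forall k l, k != l ->
        (`|ratio p k| + `|ratio p l|) / 2 < `|center p k - center p l|]);
  last first.
  apply/seteqP; split => [p [H1 H2 H3]|p [[[H1 H1'] H2] H3]].
    by split => //; split => //; split => k; have /andP[] := H1 k.
  by split => // k; rewrite H1 H1'.
apply: measurableI; [apply: measurableI; [apply: measurableI|]|];
    apply: measurable_forall => k.
- by apply: measurable_lt_set => //; exact: measurable_abs_ratio.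
- by apply: measurable_lt_set => //; exact: measurable_abs_ratio.
- apply: measurable_le_set.
    by apply: measurable_abs; apply: measurable_funB => //; exact: mc.
  apply: measurable_funM => //; apply: measurable_funB => //.
  exact: measurable_abs_ratio.
apply: measurable_forall => l; have [->|kl] := eqVneq k l.
  by rewrite (_ : [set _ | _] = setT)//; apply/seteqP.
rewrite (_ : [set _ | _] = [set p : T | (`|ratio p k| + `|ratio p l|) / 2 <
    `|center p k - center p l|]); last first.
  by apply/seteqP; split => p /= H; [exact: H|move=> _].
apply: measurable_lt_set.
  by apply: measurable_funM => //; apply: measurable_funD;
    exact: measurable_abs_ratio.
by apply: measurable_abs; apply: measurable_funB => //; exact: mc.
Qed.

End one_tuple.

Section two_tuples.
Variables (m m' : nat) (k0 : 'I_m) (k0' : 'I_m').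
Local Notation T := ((m + m).-tuple mR).
Local Notation T' := ((m' + m').-tuple mR).

Definition sum_points (p : T) (q : T') (uv : seq 'I_m * seq 'I_m') : R :=
  cylinder_point k0 p uv.1 + cylinder_point k0' q uv.2.

(** For fixed exponents this set is measurable, and all the pairs of parameters
    to be excluded lie in countably many such sets: Hausdorff
    dimension is replaced by sums of powers of the ratios, and the sum of the
    two Cantor sets by the closure of a countable subset. *)
Definition exceptional (a b : R) : set (T * T') :=
  [set pq | [/\ disjoint_contraction pq.1, disjoint_contraction pq.2,
    1 < ratio_sum pq.1 a, 1 < ratio_sum pq.2 b &
    lebesgue_measure (closure (range (sum_points pq.1 pq.2))) = 0%E]].

Lemma measurable_null_sum_closure : measurable [set pq : T * T' |
  lebesgue_measure (closure (range (sum_points pq.1 pq.2))) = 0%E].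
Proof.
pose E : set ((T * T') * mR) :=
  [set x | closure (range (sum_points x.1.1 x.1.2)) x.2].
have mE : measurable E.
  rewrite (_ : E = \bigcap_k \bigcup_uv
    [set x : (T * T') * mR | `|x.2 - sum_points x.1.1 x.1.2 uv| < k.+1%:R^-1]).
    apply: bigcapT_measurable => k; apply: countable_bigcupT_measurable => // uv.
    apply: measurable_lt_set => //; apply: measurable_abs.
    apply: measurable_funB => //; apply: measurable_funD.
      apply: (measurableT_comp (measurable_cylinder_point k0 uv.1)).
      exact: measurableT_comp.
    apply: (measurableT_comp (measurable_cylinder_point k0' uv.2)).
    exact: measurableT_comp.
  by apply/seteqP; split => x; rewrite /E/= closure_rangeE.
have := measurable_fun_xsection (@lebesgue_measure R) mE.
move=> /(_ measurableT [set 0%E]) /(_ (emeasurable_set1 _)).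
rewrite setTI; congr (measurable _); apply/seteqP; split => pq /=;
  by rewrite (_ : xsection E pq = closure (range (sum_points pq.1 pq.2)))//;
    apply/seteqP; split => z; rewrite /xsection/= inE.
Qed.

Lemma measurable_exceptional a b : measurable (exceptional a b).
Proof.
rewrite (_ : exceptional a b =
  (fst @^-1` [set p : T | disjoint_contraction p]) `&`
  (snd @^-1` [set p : T' | disjoint_contraction p]) `&`
  [set pq : T * T' | 1 < ratio_sum pq.1 a] `&`
  [set pq : T * T' | 1 < ratio_sum pq.2 b] `&`
  [set pq : T * T' |
    lebesgue_measure (closure (range (sum_points pq.1 pq.2))) = 0%E]); last first.
  by apply/seteqP; split => [pq []|pq [[[[]]]]].
apply: measurableI; last exact: measurable_null_sum_closure.
apply: measurableI; last first.
  apply: measurable_lt_set => //.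
  exact: (measurableT_comp (measurable_ratio_sum b)).
apply: measurableI; last first.
  apply: measurable_lt_set => //.
  exact: (measurableT_comp (measurable_ratio_sum a)).
by apply: measurableI; rewrite -[X in measurable X]setTI;
  [apply: measurable_fst|apply: measurable_snd] => //;
  exact: measurable_disjoint_contraction.
Qed.

End two_tuples.
End measurable_parameters.

(** * Dilating one of the Cantor sets *)

Section dilation.
Context {R : realType}.
Local Notation mR := (measurableTypeR R).
Local Notation mu := (@lebesgue_measure R).

Definition dilation_factor (m : nat) (t : R) (i : 'I_(m + m)) : R :=
  if (i < m)%N then 1 else t.

(** Multiplying the translations by [t] conjugates every [affine_map q k] by
    the dilation of factor [t], hence multiplies the Cantor set by [t]. *)
Definition dilate (m : nat) (t : R) (q : (m + m).-tuple mR) :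
    (m + m).-tuple mR := tuple_scale (dilation_factor t) q.

Section dilate_theory.
Variables (m : nat) (t : R) (q : (m + m).-tuple mR).

Lemma ratio_dilate k : ratio (dilate t q) k = ratio q k.
Proof.
by rewrite /ratio tnth_mktuple /dilation_factor/= ltn_ord mul1r.
Qed.

Lemma translation_dilate k : translation (dilate t q) k = t * translation q k.
Proof.
by rewrite /translation tnth_mktuple /dilation_factor/= ltnNge leq_addr.
Qed.

Lemma ratio_sum_dilate a : ratio_sum (dilate t q) a = ratio_sum q a.
Proof. by apply: eq_bigr => k _; rewrite ratio_dilate. Qed.

Lemma cylinder_point_dilate k0 u :
  cylinder_point k0 (dilate t q) u = t * cylinder_point k0 q u.
Proof.
elim: u => [|k u ih].
  by rewrite /cylinder_point/= /fixed_point ratio_dilate translation_dilate mulrA.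
have cons (s : (m + m).-tuple R) : cylinder_point k0 s (k :: u) =
  ratio s k * cylinder_point k0 s u + translation s k by [].
rewrite !cons ih ratio_dilate translation_dilate; ring.
Qed.

End dilate_theory.

Variables (m m' : nat) (k0 : 'I_m) (k0' : 'I_m').
Variables (a b : R).
Hypotheses (a0 : 0 <= a) (b0 : 0 <= b) (ab1 : a + b = 1).

(** If one dilate of [q] is exceptional, then the separation of its cylinders
    gives a separation of the points [cylinder_point k0' q], so that both clouds
    of points have bounded energies and [marstrand] applies. *)
Lemma exceptional_dilate_null p q :
  mu.-negligible [set t : R | 1 < t < 2 /\
    exceptional k0 k0' a b (p, dilate t q)].
Proof.
set X := [set t | _].
have [->|/set0P[t0 [/andP[t1 t2] [/= dp dq Zp Zq _]]]] := eqVneq X set0.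
  exact: negligible_set0.
rewrite ratio_sum_dilate in Zq.
have t00 : 0 < t0 by rewrite (lt_trans _ t1).
have [rp rp01 Hrp] := ratio_bound dp.
have [rq rq01 Hrq0] := ratio_bound dq.
have Hrq k : 0 < `|ratio q k| <= rq by have := Hrq0 k; rewrite ratio_dilate.
pose rho := Num.max rp rq.
have rho01 : 0 < rho < 1.
  by move: rp01 rq01 => /andP[? ?] /andP[? ?]; rewrite /rho lt_max gt_max; lra.
have [rho0 rho1] := andP rho01.
have [d d0 gapp] := affine_map_gap dp.
have [d' d0' gapq] := affine_map_gap dq.
have [Mp HMp] : exists M, forall n r, 0 < r -> rho ^+ n <= r ->
    energy (words m n) (word_weight (gibbs p a)) (cylinder_point k0 p) a r <= M.
  apply: (energy_words_le a0 _ d0) => // [k|k l u v kl].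
    by have /andP[-> h] := Hrp k; rewrite le_max h.
  by apply: gapp => //; exact: cylinder_point_itv.
have [Mq HMq] : exists M, forall n r, 0 < r -> rho ^+ n <= r ->
    energy (words m' n) (word_weight (gibbs q b)) (cylinder_point k0' q) b r <= M.
  (* Undoing the dilation by t0 < 2 costs at most a factor 2. *)
  have d'2 : 0 < d' / 2 by rewrite divr_gt0.
  apply: (energy_words_le b0 _ d'2) => // [k|k l u v kl].
    by have /andP[-> h] := Hrq k; rewrite le_max h orbT.
  have := gapq k l _ _ kl (cylinder_point_itv k0' u dq) (cylinder_point_itv k0' v dq).
  rewrite -[affine_map _ k _]/(cylinder_point k0' (dilate t0 q) (k :: u)).
  rewrite -[affine_map _ l _]/(cylinder_point k0' (dilate t0 q) (l :: v)).
  rewrite !cylinder_point_dilate -mulrBr normrM (gtr0_norm t00) => h.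
  by rewrite ler_pdivrMr// mulrC (le_trans h)// ler_wpM2r// ltW.
have gibbs_ge0 mm (s : (mm + mm).-tuple R) c k : 1 < ratio_sum s c ->
    0 <= gibbs s c k.
  by move=> h; rewrite divr_ge0 ?powR_ge0// ltW// (lt_trans _ h).
have gibbs_sum1 mm (s : (mm + mm).-tuple R) c n : 1 < ratio_sum s c ->
    \sum_(u <- words mm n) word_weight (gibbs s c) u = 1.
  move=> h; rewrite sum_word_weight /gibbs -mulr_suml mulfV ?expr1n//.
  by rewrite gt_eqF// (lt_trans _ h).
have E t : (fun uv : seq 'I_m * seq 'I_m' =>
    cylinder_point k0 p uv.1 + t * cylinder_point k0' q uv.2) =
    sum_points k0 k0' p (dilate t q).
  by apply/funext => -[u v]; rewrite /sum_points cylinder_point_dilate.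
suff : mu.-negligible [set t : R | 1 < t < 2 /\ mu (closure (range
    (fun uv : seq 'I_m * seq 'I_m' =>
      cylinder_point k0 p uv.1 + t * cylinder_point k0' q uv.2))) = 0%E].
  apply: negligibleS => t; rewrite /X/exceptional/= => -[t12 [_ _ _ _ null]].
  by split => //; rewrite E.
apply: (@marstrand R _ _ (word_weight (gibbs p a)) (cylinder_point k0 p)
  (word_weight (gibbs q b)) (cylinder_point k0' q) (words m) (words m')
  (fun n => rho ^+ n) a b (Num.max Mp Mq) 1 a0 b0 ab1).
- by move=> u; apply: word_weight_ge0 => k; exact: gibbs_ge0.
- by move=> u; apply: word_weight_ge0 => k; exact: gibbs_ge0.
- by move=> n; exact: gibbs_sum1.
- by move=> n; exact: gibbs_sum1.
- move=> u; have /andP[h1 h2] := cylinder_point_itv k0 u dp.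
  by rewrite ger0_norm.
- move=> u; have := cylinder_point_itv k0' u dq.
  rewrite cylinder_point_dilate pmulr_rge0// => /andP[h1 h2].
  by rewrite ger0_norm//; apply: le_trans h2; rewrite ler_peMl// ltW.
- by move=> n; exact: exprn_gt0.
- by apply: cvg_expr; rewrite gtr0_norm.
- by move=> n; rewrite le_max HMp ?exprn_gt0.
- by move=> n; rewrite le_max HMq ?exprn_gt0// orbT.
Qed.

Lemma exceptional_null :
  (@lebesgue_tuple R (m + m) \x @lebesgue_tuple R (m' + m'))%E
    (exceptional k0 k0' a b) = 0%E.
Proof.
apply/product_measure_null; first exact: measurable_exceptional.
apply: aeW => /= p.
apply: (@null_of_null_on_curves _ _ (fun t => @dilation_factor m' t)).
- move=> t i /andP[t1 _]; rewrite /dilation_factor/=; case: ifP => // _.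
  exact: lt_trans ltr01 t1.
- by move=> i; rewrite /dilation_factor; case: (i < m')%N.
- by apply: measurable_xsection; exact: measurable_exceptional.
- move=> q; apply: negligibleS (exceptional_dilate_null p q) => t [t12].
  by rewrite /xsection/= inE.
Qed.

End dilation.

(** The number [ratr x] is taken between [1 - D'] and [D], except when one of
    the dimensions exceeds [1], where the other exponent can be [0].  It is
    rational so that only countably many exceptional sets are needed. *)
Lemma exponent_between (R : realType) (D D' : \bar R) :
  (0 <= D)%E -> (0 <= D')%E -> (1 < D + D')%E ->
  exists x : rat, [/\ 0 <= ratr x :> R, 0 <= 1 - ratr x :> R,
    ratr x = 0 :> R \/ ((ratr x)%:E < D)%E &
    1 - ratr x = 0 :> R \/ ((1 - ratr x)%:E < D')%E].
Proof.
move=> D0 D0' DD.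
have [D1|D1] := ltP 1%E D.
  by exists 1; rewrite rmorph1 subrr; split => //; [right|left].
have [D1'|D1'] := ltP 1%E D'.
  by exists 0; rewrite rmorph0 subr0; split => //; [left|right].
case: D D' D0 D0' DD D1 D1' => [D| |] [D'| |] //.
rewrite -EFinD !lee_fin lte_fin => D0 D0' DD D1 D1'.
have /rat_in_itvoo[x] : 1 - D' < D by lra.
rewrite in_itv/= => /andP[x1 x2]; exists x.
by split; [lra|lra|right|right]; rewrite lte_fin; lra.
Qed.

Local Open Scope ereal_scope.

Theorem corollary1p2 (R : realType) (m m' : nat)
    (hm : (2 <= m)%N) (hm' : (2 <= m')%N) :
  {ae (@lebesgue_tuple R (m + m)%N \x @lebesgue_tuple R (m' + m')%N),
    forall pq, admissible pq.1 -> admissible pq.2 ->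
      1 < hausdorff_dim (affine_cantor pq.1) + hausdorff_dim (affine_cantor pq.2) ->
      0 < lebesgue_measure (sumset (affine_cantor pq.1) (affine_cantor pq.2))}.
Proof.
pose k0 : 'I_m := Ordinal (ltnW hm).
pose k0' : 'I_m' := Ordinal (ltnW hm').
pose ex n : R := ratr (odflt 0%R (unpickle n : option rat)).
pose N n := if ((0 <= ex n) && (0 <= 1 - ex n))%R
  then exceptional k0 k0' (ex n) (1 - ex n)%R else set0.
have N0 n : (@lebesgue_tuple R (m + m)%N \x @lebesgue_tuple R (m' + m')%N).-negligible (N n).
  rewrite /N; case: ifPn => [/andP[a0 b0]|_]; last exact: negligible_set0.
  apply/negligibleP; first exact: measurable_exceptional.
  by apply: exceptional_null => //; rewrite addrC subrK.
apply: negligibleS (negligible_bigcup N0) => pq /= Hbad.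
have [ap [aq [DD mu0]]] : admissible pq.1 /\ admissible pq.2 /\
    1 < hausdorff_dim (affine_cantor pq.1) + hausdorff_dim (affine_cantor pq.2) /\
    lebesgue_measure (sumset (affine_cantor pq.1) (affine_cantor pq.2)) = 0.
  apply: contrapT => H; apply: Hbad => ap aq DD.
  rewrite lt0e measure_ge0 andbT; apply/eqP => mu0; exact: H.
have dp := admissible_disjoint_contraction ap.
have dq := admissible_disjoint_contraction aq.
have dim0 n (r : (n + n).-tuple R) : 0 <= hausdorff_dim (affine_cantor r).
  by apply: le_ereal_inf_tmp => _ [s [s0 _] <-]; rewrite lee_fin.
have [x [a0 b0 aD bD]] := exponent_between (dim0 _ _) (dim0 _ _) DD.
exists (pickle x) => //; rewrite /N /ex pickleK/= a0 b0/=.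
have [rp rp01 Hrp] := ratio_bound dp.
have [rq rq01 Hrq] := ratio_bound dq.
split => //.
- exact: ratio_sum_gt1 Hrp aD.
- exact: ratio_sum_gt1 Hrq bD.
apply/eqP; rewrite -measure_le0 -mu0; apply: le_measure; rewrite ?inE.
- apply: closed_measurable; exact: closed_closure.
- apply: closed_measurable; apply: sumset_closed; exact: affine_cantor_compact.
- exact: closure_cylinder_points_sumset.
Qed.
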